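(* Assume the continuum hypothesis. Let $\lambda$ be a cardinal with $\omega_1<\lambda<2^{\omega_1}$, and suppose that there is a model $\mathcal M$ of cardinality $\omega_1$ with exactly $\lambda$ automorphisms. Then there exists a tree $T$ of height $\omega_1$ such that (i) $T$ has exactly $\lambda$ uncountable branches, and (ii) each level of $T$ has at most $\omega_1$ nodes.
   Context: A tree is a partially ordered set in which the set of predecessors of every node is well-ordered; the height of a node is the order type of its set of predecessors, and the levels are the sets of nodes of a given height. A branch is a maximal linearly ordered subset; in a tree of height $\omega_1$ the uncountable branches are those of order type $\omega_1$. Models are structures for an arbitrary vocabulary of finitary symbols. *)

(* Defs.v *)
From HB Require Import structures.
From mathcomp Require Import all_boot all_order.
From mathcomp Require Import boolp wochoice classical_sets functions cardinality.

Set Implicit Arguments.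
Unset Strict Implicit.
Unset Printing Implicit Defensive.
Import Order.TTheory.
Local Open Scope order_scope.
Local Open Scope classical_set_scope.
Local Open Scope card_scope.

(* A cardinal is represented by an arbitrary type (or set) of that cardinality,
   and cardinals are compared with [#<=] and [#=]. *)
Definition card_lt (T U : Type) (A : set T) (B : set U) : Prop :=
  A #<= B /\ ~ (B #<= A).

(* [W] has order type omega_1, the least uncountable ordinal. The ordinals
   below omega_1 are then the elements of [W], where [w] stands for the order
   type of [[set v | v < w]]. *)
Definition is_omega1 (d : Order.disp_t) (W : orderType d) : Prop :=
  [/\ well_order (<=%O : rel W),
      ~ countable [set: W] &
      forall w : W, countable [set v : W | v < w]].

Lemma omega1_exists :
  exists (d : Order.disp_t) (W : orderType d), is_omega1 W.
Proof.
have cantor : ~ countable [set: set nat].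
  case/countable_injP=> f finj.
  pose D := [set n | exists2 A : set nat, f A = n & ~ A n].
  have nDf : ~ D (f D).
    by move=> DfD; case: (DfD) => A /finj; rewrite !in_setT => ->.
  by apply: (nDf); exists D.
have [R Rwo] := well_ordering_principle (set nat).
have Rch := wo_chainW (@withinW _ predT _ Rwo).
have Rtot : total R by move=> x y; exact: Rch.
have Ranti : antisymmetric R.
  move=> x y.
  exact: (wo_chain_antisymmetric (@withinW _ predT _ Rwo)).
have Rrefl : reflexive R by move=> x; have := Rtot x x; rewrite orbb.
have Rtrans : transitive R.
  move=> y x z Rxy Ryz.
  have [|m [[mA mlb] _]] := Rwo [pred t | [|| t == x, t == y | t == z]].
    by exists x; rewrite inE eqxx.
  have lbx : R m x by apply: mlb; rewrite inE eqxx.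
  have lby : R m y by apply: mlb; rewrite inE eqxx orbT.
  have lbz : R m z by apply: mlb; rewrite inE eqxx !orbT.
  move: mA; rewrite inE => /or3P[/eqP mE | /eqP mE | /eqP mE]; subst m.
  - exact: lbz.
  - by have -> : x = y by apply: Ranti; rewrite Rxy.
  - by have -> : z = y by apply: Ranti; rewrite lby.
pose small x := `[< countable [set y | R y x /\ y != x] >].
pose W0 := {x : set nat | small x}.
pose leW (x y : W0) := R (val x) (val y).
have leW_refl : reflexive leW by move=> x; exact: Rrefl.
have leW_anti : antisymmetric leW by move=> x y /Ranti /val_inj.
have leW_trans : transitive leW by move=> y x z; exact: Rtrans.
have leW_total : total leW by move=> x y; exact: Rtot.
pose poW := Order.Le_isPOrder.Build (Order.Disp tt tt) W0
  leW_refl leW_anti leW_trans.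
pose POW : porderType _ := HB.pack W0 poW.
pose totW := Order.POrder_isTotal.Build (Order.Disp tt tt) POW leW_total.
pose OW : orderType _ := HB.pack W0 poW totW.
exists (Order.Disp tt tt), OW; split.
- apply: antisymmetric_well_order => [|A [x Ax]]; first exact: leW_anti.
  have [|m [[mA mlb] _]] := Rwo [pred y | `[< exists2 w : W0, w \in A & val w = y >]].
    by exists (val x); apply/asboolP; exists x.
  case/asboolP: mA => w wA wm.
  exists w; split=> // v vA; change (R (val w) (val v)); rewrite wm.
  by apply: mlb; apply/asboolP; exists v.
- move=> cW; have cS : countable [set x | small x].
    suff <- : [set val w | w in [set: OW]] = [set x | small x].
      exact: card_le_trans (card_image_le _ _) cW.
    apply/seteqP; split=> [_ [w _ <-]|x sx]; first exact: (valP w).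
    by exists (exist _ x sx).
  have [[x nsx] | all_small] := pselect (exists x, ~~ small x); last first.
    apply: cantor; apply: sub_countable cS; apply: subset_card_le => x _ /=.
    by apply: contrapT => nsx; apply: all_small; exists x; apply/negP.
  have [|m [[mS mlb] _]] := Rwo [pred y | ~~ small y]; first by exists x.
  move: mS; rewrite inE => /negP; apply; apply/asboolP.
  apply: sub_countable cS; apply: subset_card_le => y [Rym ym] /=.
  apply: contrapT => /negP nsy; case/negP: ym; apply/eqP/Ranti.
  by rewrite Rym mlb.
- move=> w; have /asboolP cw : small (val (w : W0)) by exact: (valP (w : W0)).
  suff cI : countable [set val (v : W0) | v in [set v : OW | v < w]].
    apply: sub_countable cI.
    suff : [set val (v : W0) | v in [set v : OW | v < w]] #= [set v : OW | v < w].
      by rewrite card_eq_le => /andP[].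
    by apply: inj_card_eq => u v _ _ /val_inj.
  apply: sub_countable cw; apply: subset_card_le => _ [v /= vw <-].
  split; first exact: (ltW vw : leW v w).
  by apply: contraTneq vw => /val_inj ->; rewrite ltxx.
Qed.

Definition continuum_hypothesis (d : Order.disp_t) (W : orderType d) : Prop :=
  [set: nat -> bool] #= [set: W].

(* Constants are function symbols of arity 0. There is no restriction on the
   number of symbols. *)
Record vocabulary := Vocabulary {
  fun_symbol : Type;
  fun_arity : fun_symbol -> nat;
  rel_symbol : Type;
  rel_arity : rel_symbol -> nat }.

Record model (V : vocabulary) := Model {
  universe :> Type;
  fun_interp : forall s : fun_symbol V,
    (fun_arity s).-tuple universe -> universe;
  rel_interp : forall s : rel_symbol V,
    (rel_arity s).-tuple universe -> Prop }.

Definition automorphism (V : vocabulary) (M : model V) (g : M -> M) : Prop :=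
  [/\ bijective g,
      forall (s : fun_symbol V) (t : (fun_arity s).-tuple M),
        g (fun_interp t) = fun_interp (map_tuple g t) &
      forall (s : rel_symbol V) (t : (rel_arity s).-tuple M),
        rel_interp t <-> rel_interp (map_tuple g t)].

Definition is_tree (d : Order.disp_t) (T : porderType d) : Prop :=
  forall x : T, wo_chain (<=%O : rel T) [pred y : T | y < x].

Section Height.
Variables (dW dT : Order.disp_t) (W : orderType dW) (T : porderType dT).

(* The predecessors of [x] have the same order type as the initial segment of
   [W] below [w]. *)
Definition has_height (x : T) (w : W) : Prop :=
  exists2 f : T -> W,
    set_bij [set y : T | y < x] [set v : W | v < w] f &
    forall y z : T, y < x -> z < x -> (f y <= f z) = (y <= z).

Definition level (w : W) : set T := [set x | has_height x w].

(* The height of a tree is the least ordinal [alpha] such that there is no node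
   of height [alpha]; here it is the order type of [W]. *)
Definition tree_height : Prop :=
  (forall x : T, exists w : W, has_height x w) /\
  (forall w : W, level w !=set0).

End Height.

Arguments level {dW dT W} T w.
Arguments tree_height {dW dT} W T.

Definition branch (d : Order.disp_t) (T : porderType d) (B : set T) : Prop :=
  total_on B <=%O /\
  forall C : set T, total_on C <=%O -> B `<=` C -> C = B.

(* Main.v *)
(* The tree consists of the restrictions of the pairs [(g, g^-1)], for [g] an
   automorphism, to the initial segments of omega_1 (with which the universe is
   identified). As the symbols of the vocabulary are finitary, a pair of maps
   whose restriction to every initial segment agrees with such a pair is itself
   of this form, so the uncountable branches are the automorphisms. A node is a
   countable sequence of elements of a set of size at most the continuum, so
   CH bounds the number of nodes. *)
Require Import Defs.
From HB Require Import structures.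
From mathcomp Require Import all_boot all_order.
From mathcomp Require Import boolp wochoice classical_sets functions cardinality.
Local Open Scope order_scope.
Local Open Scope classical_set_scope.
Local Open Scope card_scope.

Set Implicit Arguments.
Unset Strict Implicit.
Unset Printing Implicit Defensive.
Import Order.TTheory.

(** * Coding by reals, and unboundedness of $\omega_1$ *)

Lemma card_le_bool_fun (I : countType) (T : Type) (f : T -> I -> bool) :
  injective f -> [set: T] #<= [set: nat -> bool].
Proof.
move=> f_inj; apply/pcard_injP.
exists (fun x k => if unpickle k is Some i then f x i else false).
move=> x y _ _ xy; apply: f_inj; apply: funext => i.
by have := congr1 (@^~ (pickle i)) xy; rewrite /= pickleK.
Qed.

(** With a largest element, [W] would be a countable initial segment plus one point. *)
Lemma omega1_unbounded (d : Order.disp_t) (W : orderType d) :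
  is_omega1 W -> forall v : W, exists w, v < w.
Proof.
move=> [_ nW cW] v; apply: contrapT => nv; apply: nW.
have: countable ([set u | u < v] `|` [set v]).
  by rewrite -bigcup2E; apply: bigcup_countable => // -[|[|n]] _ /=.
apply: sub_countable; apply: subset_card_le => u _ /=.
case: (ltgtP u v) => [uv|vu|->]; [by left | | by right].
by case: nv; exists u.
Qed.

(** * Agreement of functions on initial segments *)

Section Agreement.
Variables (d : Order.disp_t) (W : orderType d) (X : Type).
Implicit Types (g h k : W -> X) (v w : W).

Definition agree w g h := forall v, v < w -> g v = h v.

Lemma agree_sym w g h : agree w g h -> agree w h g.
Proof. by move=> gh v /gh. Qed.

Lemma agree_trans w g h k : agree w g h -> agree w h k -> agree w g k.
Proof. by move=> gh hk v vw; rewrite gh ?hk. Qed.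

Lemma agree_le v w g h : v <= w -> agree w g h -> agree v g h.
Proof. by move=> vw gh u uv; apply/gh/(lt_le_trans uv). Qed.

(** Closedness in the topology of agreement on initial segments: functions glued from restrictions
    of members of [F] stay in [F]. *)
Definition locally_closed (F : set (W -> X)) :=
  forall h, (forall w, exists2 g, F g & agree w g h) -> F h.

End Agreement.

(** * The tree of restrictions *)

(* The nodes of the tree: a restriction of [g] to the initial segment below [w]
   is encoded as [w] paired with the set of all functions sharing it. *)
Section RestrictionTree.
Variables (d : Order.disp_t) (W : orderType d) (X : Type) (F : set (W -> X)).

Definition is_restriction (p : W * set (W -> X)) : bool :=
  `[< exists2 g, F g & p.2 = agree p.1 g >].

Definition restr_tree : Type := {p | is_restriction p}.
HB.instance Definition _ := Choice.on restr_tree.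
Implicit Types x y z : restr_tree.

(** Longer restrictions have fewer extensions, hence the reversed inclusion. Domains are compared
    separately: these sets do not determine them when [X] is a singleton. *)
Definition restr_le x y : bool :=
  ((val x).1 <= (val y).1) && `[< (val y).2 `<=` (val x).2 >].

Lemma restr_le_refl : reflexive restr_le.
Proof. by move=> x; apply/andP; split=> //; apply/asboolP. Qed.

Lemma restr_le_anti : antisymmetric restr_le.
Proof.
move=> x y /andP[/andP[xy1 /asboolP xy2] /andP[yx1 /asboolP yx2]].
apply: val_inj; rewrite (surjective_pairing (val x)).
rewrite (surjective_pairing (val y)); congr (_, _).
- by apply/le_anti; rewrite xy1.
- exact/seteqP.
Qed.

Lemma restr_le_trans : transitive restr_le.
Proof.
move=> y x z /andP[xy1 /asboolP xy2] /andP[yz1 /asboolP yz2].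
apply/andP; split; first exact: le_trans yz1.
exact/asboolP/(subset_trans yz2).
Qed.

HB.instance Definition _ := Order.Le_isPOrder.Build (Order.Disp tt tt)
  restr_tree restr_le_refl restr_le_anti restr_le_trans.

Definition domain x : W := (val x).1.
Definition extension x : W -> X := projT1 (cid2 (asboolW (valP x))).

Lemma extensionP x : F (extension x).
Proof. by rewrite /extension; case: cid2. Qed.

Lemma valE x : (val x).2 = agree (domain x) (extension x).
Proof. by rewrite /extension; case: cid2. Qed.

Lemma restr_leP x y : x <= y <->
  domain x <= domain y /\ agree (domain x) (extension x) (extension y).
Proof.
split=> [/andP[le_xy /asboolP]|[le_xy xy]].
  by rewrite !valE => sub; split=> //; apply: sub.
apply/andP; split=> //; apply/asboolP; rewrite !valE => h yh.
exact/(agree_trans xy)/(agree_le le_xy).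
Qed.

Lemma restr_eq x y : domain x = domain y ->
  agree (domain x) (extension x) (extension y) -> x = y.
Proof.
move=> dxy xy; apply/le_anti/andP; split; apply/restr_leP.
  by split=> //; rewrite dxy.
by rewrite -dxy; split=> //; apply: agree_sym.
Qed.

Lemma restr_ltP x y : x < y <->
  domain x < domain y /\ agree (domain x) (extension x) (extension y).
Proof.
rewrite [x < y]lt_neqAle; split=> [/andP[nxy /restr_leP[dxy xy]]|[dxy xy]].
  split=> //; rewrite lt_neqAle dxy andbT; apply: contra nxy => /eqP dE.
  exact/eqP/restr_eq.
apply/andP; split; last by apply/restr_leP; split=> //; exact: ltW.
by apply: contraTneq dxy => ->; rewrite ltxx.
Qed.

Definition restr g (Fg : F g) w : restr_tree :=
  exist _ (w, agree w g) (asboolT (ex_intro2 _ _ g Fg erefl)).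

Lemma domain_restr g (Fg : F g) w : domain (restr Fg w) = w.
Proof. by []. Qed.

Lemma extension_restr g (Fg : F g) w :
  agree w (extension (restr Fg w)) g.
Proof. by have := valE (restr Fg w); rewrite /= domain_restr => <-. Qed.
Arguments extension_restr {g} Fg w.

Lemma restr_le_restr g (Fg : F g) v w :
  (restr Fg v <= restr Fg w) = (v <= w).
Proof.
apply/idP/idP => [/restr_leP[] //|vw]; apply/restr_leP; split=> //.
rewrite domain_restr; apply: (agree_trans (extension_restr Fg v)).
exact/agree_sym/(agree_le vw)/extension_restr.
Qed.

(** Below [x] all nodes restrict the single function [extension x], so [domain] identifies the
    predecessors of [x] with an initial segment of [W]. *)
Lemma below_restr x y : y <= x -> y = restr (extensionP x) (domain y).
Proof.
move=> /restr_leP[_ yx]; apply: restr_eq => //.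
exact/(agree_trans yx)/agree_sym/extension_restr.
Qed.

Lemma restr_domain x : x = restr (extensionP x) (domain x).
Proof. exact: below_restr. Qed.

Lemma restr_has_height x : has_height x (domain x).
Proof.
exists domain => [|y z yx zx]; last first.
  rewrite [in RHS](below_restr (ltW yx)) [in RHS](below_restr (ltW zx)).
  by rewrite restr_le_restr.
split=> [y /restr_ltP[] //|y z|v /= vx].
- rewrite !inE /= => yx zx dyz.
  by rewrite (below_restr (ltW yx)) (below_restr (ltW zx)) dyz.
- exists (restr (extensionP x) v) => //=.
  rewrite [X in _ < X](restr_domain x) lt_neqAle restr_le_restr (ltW vx) andbT.
  apply: contraTneq vx => /(congr1 domain); rewrite !domain_restr => ->.
  by rewrite ltxx.
Qed.

Lemma restr_tree_is_tree : well_order (<=%O : rel W) -> is_tree restr_tree.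
Proof.
move=> wo x; apply: antisymmetric_wo_chain => [y z _ _ /le_anti //|A sA [y Ay]].
(* Below [x] the order is that of the domains, so a node of [A] with least domain is least. *)
have [|w [[Aw lb] _]] := wo [pred v | `[< exists2 z, z \in A & domain z = v >]].
  by exists (domain y); apply/asboolP; exists y.
case/asboolP: Aw => z zA zw; exists z; split=> // t tA.
have [zx tx] : z <= x /\ t <= x by split; apply/ltW/sA.
rewrite (below_restr zx) (below_restr tx) restr_le_restr zw.
by apply: lb; apply/asboolP; exists t.
Qed.

(** * Branches and functions *)

Definition restr_branch g : set restr_tree :=
  [set x | agree (domain x) (extension x) g].

Lemma restr_in_branch g (Fg : F g) w : restr_branch g (restr Fg w).
Proof. exact: extension_restr. Qed.
Arguments restr_in_branch {g} Fg w.

Lemma restr_branchE g (Fg : F g) x :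
  restr_branch g x -> x = restr Fg (domain x).
Proof.
move=> xg; apply: restr_eq => //.
exact/(agree_trans xg)/agree_sym/extension_restr.
Qed.

Lemma restr_branch_total g : F g -> total_on (restr_branch g) <=%O.
Proof.
move=> Fg x y /(restr_branchE Fg) -> /(restr_branchE Fg) ->.
by rewrite !restr_le_restr; apply/orP; exact: le_total.
Qed.

(** A node [x] of a larger chain is comparable with the restriction of [g] to the same domain, hence
    agrees with [g]. *)
Lemma restr_branchP g : F g -> branch (restr_branch g).
Proof.
move=> Fg; split=> [|C Ctot gC]; first exact: restr_branch_total.
apply/seteqP; split=> // x Cx; rewrite /restr_branch /=.
have Cr := gC _ (restr_in_branch Fg (domain x)).
apply: agree_trans (extension_restr Fg (domain x)).
by case: (Ctot _ _ Cx Cr) => /restr_leP[_ //]; apply: agree_sym.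
Qed.

Lemma restr_branch_inj : (forall v : W, exists w, v < w) ->
  {in F &, injective restr_branch}.
Proof.
move=> unbounded g h; rewrite !inE => Fg Fh gh; apply: funext => v.
have [w vw] := unbounded v.
have := restr_in_branch Fg w; rewrite gh => /(_ v vw) <-.
by rewrite (extension_restr Fg w).
Qed.

Lemma restr_branch_uncountable g : F g ->
  ~ countable [set: W] -> ~ countable (restr_branch g).
Proof.
move=> Fg nW cB; apply: nW; apply: sub_countable cB.
apply: card_le_trans (card_image_le domain (restr_branch g)).
apply: subset_card_le => w _.
by exists (restr Fg w); first exact: restr_in_branch.
Qed.

Hypothesis omega1_W : is_omega1 W.

(** Nodes of a chain are determined by their domains, and initial segments of [W] are countable, so
    the domains in [B] are unbounded. The nodes of [B] thus glue to a total function [h], which is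
    in [F] by local closedness; maximality of [B] gives equality. *)
Lemma uncountable_branchP (B : set restr_tree) :
  locally_closed F -> branch B -> ~ countable B ->
  exists2 g, F g & restr_branch g = B.
Proof.
move=> Fcl [Btot Bmax] nB.
have Binj x y : B x -> B y -> domain x = domain y -> x = y.
  move=> Bx By dxy; apply: restr_eq => //.
  by case: (Btot _ _ Bx By) => /restr_leP[_ //]; rewrite -dxy; apply: agree_sym.
have Bcof v : exists2 x, B x & v < domain x.
  apply: contrapT => nv; apply: nB.
  have [w vw] := omega1_unbounded omega1_W v; have [_ _ /(_ w) cw] := omega1_W.
  apply: sub_countable cw; apply: card_le_trans (_ : domain @` B #<= _).
    suff: domain @` B #= B by rewrite card_eq_le => /andP[].
    by apply: inj_card_eq => x y; rewrite !inE; exact: Binj.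
  apply: subset_card_le => _ [x Bx <-]; apply: le_lt_trans vw.
  by rewrite leNgt; apply/negP => vx; apply: nv; exists x.
pose top v := projT1 (cid2 (Bcof v)).
have topB v : B (top v) by rewrite /top; case: cid2.
have topP v : v < domain (top v) by rewrite /top; case: cid2.
pose h v := extension (top v) v.
have Bh x : B x -> agree (domain x) (extension x) h.
  move=> Bx v vx; rewrite /h.
  by case: (Btot _ _ Bx (topB v)) => /restr_leP[_ xt]; rewrite xt ?topP.
have Fh : F h.
  apply: Fcl => w; exists (extension (top w)); first exact: extensionP.
  exact: agree_le (ltW (topP w)) (Bh _ (topB w)).
exists h => //; apply: Bmax => //; exact: restr_branch_total.
Qed.

Lemma card_uncountable_branches : locally_closed F ->
  [set B : set restr_tree | branch B /\ ~ countable B] #= F.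
Proof.
move=> Fcl; have [_ nW _] := omega1_W.
have -> : [set B : set restr_tree | branch B /\ ~ countable B] =
          restr_branch @` F.
  apply/seteqP; split=> [B [Bb nB]|_ [g Fg <-]].
    by have [g Fg <-] := uncountable_branchP Fcl Bb nB; exists g.
  by split; [exact: restr_branchP | exact: restr_branch_uncountable].
exact/inj_card_eq/restr_branch_inj/omega1_unbounded/omega1_W.
Qed.

(** * Height and number of nodes *)

Lemma restr_tree_height : F !=set0 -> tree_height W restr_tree.
Proof.
move=> [g Fg]; split=> [x|w].
  by exists (domain x); exact: restr_has_height.
by exists (restr Fg w); exact: (restr_has_height (restr Fg w)).
Qed.

(* A node is a point of [W] and a countable sequence of reals, hence a real. *)
Lemma card_restr_tree :
  [set: W] #<= [set: nat -> bool] -> [set: X] #<= [set: nat -> bool] ->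
  [set: restr_tree] #<= [set: nat -> bool].
Proof.
move=> /pcard_injP[a /in2TT a_inj] /pcard_injP[b /in2TT b_inj].
have [_ _ cW] := omega1_W.
have enum w : exists s : nat -> W, forall v, v < w -> exists n, s n = v.
  have /countable_injP[i i_inj] := cW w.
  have invi n : exists v, forall u, u < w -> i u = n -> u = v.
    have [[u uw un]|nu] := pselect (exists2 u, u < w & i u = n).
      by exists u => t tw tn; apply: i_inj; rewrite ?inE ?tn.
    (* Indices not attained by [i] below [w] get the harmless default [w]. *)
    by exists w => u uw un; case: nu; exists u.
  have [s sP] := choice invi.
  by exists s => v vw; exists (i v); rewrite -(sP _ v).
have [s sP] := choice enum.
(* Row [None] spells the domain, row [Some n] the value at its [n]-th listed point. Recovering the
   domain first ensures that both nodes use the same enumeration. *)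
pose code x (i : option nat * nat) : bool :=
  if i.1 is Some n then b (extension x (s (domain x) n)) i.2
  else a (domain x) i.2.
apply: (@card_le_bool_fun _ _ code) => x y xy.
have {xy} codeE i : code x i = code y i by rewrite xy.
have dxy : domain x = domain y.
  by apply: a_inj; apply: funext => k; exact: (codeE (None, k)).
apply: restr_eq => // v /sP[n <-]; apply: b_inj; apply: funext => k.
by have := codeE (Some n, k); rewrite /code /= -dxy.
Qed.

End RestrictionTree.

(** * Local closedness of the automorphisms *)

(** Finitely many points lie in one initial segment; this is where finitary symbols will matter. *)
Lemma locally_closed_finite (d : Order.disp_t) (W : orderType d) (X : Type)
    (F : set (W -> X)) (h : W -> X) (s : seq W) :
  is_omega1 W -> (forall w, exists2 g, F g & agree w g h) ->
  exists2 g, F g & {in s, g =1 h}.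
Proof.
move=> omega1_W hF; suff [w /allP sw] : exists w, all (< w) s.
  by have [g Fg gh] := hF w; exists g => // v /sw /gh.
elim: s => [|v s [w sw]] /=.
  have [_ nW _] := omega1_W; apply: contrapT => nw; apply: nW.
  suff -> : [set: W] = set0 by [].
  by apply/seteqP; split=> // w _; apply: nw; exists w.
have [u vu] := omega1_unbounded omega1_W (Order.max v w).
exists u; move: vu; rewrite gt_max => /andP[-> wu] /=.
by apply: sub_all sw => t /= /lt_trans; apply.
Qed.

(* Recording the inverse alongside each automorphism ensures that a function
   which locally looks like an automorphism is surjective. *)
Section CodedAutomorphisms.
Variables (d : Order.disp_t) (W : orderType d) (V : vocabulary) (M : model V).
Variables (e : W -> M) (r : M -> W).
Hypothesis rK : cancel r e.

Definition coded_automorphism : set (W -> M * M) :=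
  [set h | exists g k, [/\ automorphism g, cancel g k, cancel k g &
                          forall w, h w = (g (e w), k (e w))]].

(** Forgetting the inverse is injective, since an automorphism determines it. *)
Lemma card_coded_automorphism :
  coded_automorphism #= [set g : M -> M | automorphism g].
Proof.
pose first (h : W -> M * M) (x : M) := (h (r x)).1.
have firstE h g k : (forall w, h w = (g (e w), k (e w))) -> first h = g.
  by move=> hE; apply: funext => x; rewrite /first hE /= rK.
have -> : [set g : M -> M | automorphism g] = first @` coded_automorphism.
  apply/seteqP; split=> [g ag|_ [h [g [k [ag _ _ /firstE hg]]] <-]].
    have [[k gK kK] _ _] := ag; exists (fun w => (g (e w), k (e w))).
      by exists g, k.
    exact: firstE.
  by rewrite /= hg.
rewrite card_eq_sym; apply: inj_card_eq => h h'; rewrite !inE.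
move=> [g [k [_ gK kK hE]]] [g' [k' [_ gK' kK' hE']]].
rewrite (firstE _ _ _ hE) (firstE _ _ _ hE') => gg'; subst g'.
apply: funext => w; rewrite hE hE'; congr pair.
by rewrite -{1}(kK' (e w)) gK.
Qed.

(** Each condition involves finitely many points at a time, where [h] coincides with a genuine coded
    automorphism. *)
Lemma locally_closed_coded_automorphism :
  is_omega1 W -> locally_closed coded_automorphism.
Proof.
move=> omega1_W h hF; pose g x := (h (r x)).1; pose k x := (h (r x)).2.
have fin (s : seq W) : exists g' k',
    [/\ automorphism g', cancel g' k', cancel k' g' &
    {in s, forall w, h w = (g' (e w), k' (e w))}].
  have [f [g' [k' [ag gK kK fE]]] fh] := locally_closed_finite s omega1_W hF.
  by exists g', k'; split=> // w /fh <-.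
have fin_tuple n (t : n.-tuple M) :
    exists2 g', automorphism g' & map_tuple g t = map_tuple g' t.
  have [g' [k' [ag _ _ hE]]] := fin (map_tuple r t).
  exists g' => //; apply: eq_from_tnth => i; rewrite !tnth_map /g hE ?rK //.
  by rewrite -(tnth_map r) mem_tnth.
have gK : cancel g k.
  move=> x; have [g' [k' [_ gK _ hE]]] := fin [:: r x; r (g x)].
  rewrite {1}/k hE ?inE ?eqxx ?orbT //= rK.
  by rewrite {1}/g hE ?inE ?eqxx //= rK gK.
have kK : cancel k g.
  move=> x; have [g' [k' [_ _ kK hE]]] := fin [:: r x; r (k x)].
  rewrite {1}/g hE ?inE ?eqxx ?orbT //= rK.
  by rewrite {1}/k hE ?inE ?eqxx //= rK kK.
exists g, k; split=> // [|w]; last first.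
  (* [w] may differ from [r (e w)], but [e] identifies them, so [h] takes the same value at both. *)
  have [g' [k' [_ _ _ hE]]] := fin [:: w; r (e w)].
  by rewrite /g /k !hE ?inE ?eqxx ?orbT //= rK.
split=> [|s t|s t]; first by exists k.
(* The value [fun_interp t] joins the tuple so that one [g'] matches [g] there and on the
   arguments. *)
- have [g' [_ ag _] /(congr1 val) [-> gt]] :=
    fin_tuple _ (cons_tuple (fun_interp t) t).
  by rewrite ag; congr fun_interp; apply: val_inj.
- by have [g' [_ _ ag] ->] := fin_tuple _ t; exact: ag.
Qed.

End CodedAutomorphisms.

(** * The tree of a model of size $\omega_1$ *)

Theorem proposition15 (dW : Order.disp_t) (W : orderType dW)
    (omega1_W : is_omega1 W) (CH : continuum_hypothesis W)
    (lambda : Type)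
    (lambda_gt : card_lt [set: W] [set: lambda])
    (lambda_lt : card_lt [set: lambda] [set: W -> bool])
    (V : vocabulary) (M : model V)
    (card_M : [set: M] #= [set: W])
    (card_Aut_M : [set g : M -> M | automorphism g] #= [set: lambda]) :
  exists (dT : Order.disp_t) (T : porderType dT),
    [/\ is_tree T, tree_height W T,
        [set B : set T | branch B /\ ~ countable B] #= [set: lambda] &
        forall w : W, level T w #<= [set: W]].
Proof.
have /andP[MW WM] : ([set: M] #<= [set: W]) && ([set: W] #<= [set: M]).
  by rewrite -card_eq_le.
have /andP[RW WR] :
    ([set: nat -> bool] #<= [set: W]) && ([set: W] #<= [set: nat -> bool]).
  by rewrite -card_eq_le.
have [e [r rK]] : exists e (r : M -> W), cancel r e.
  have [M0|[e]] := pfcard_geP MW.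
    have [_ []] := omega1_W; apply: sub_countable WM _.
    by rewrite M0.
  have /choice[r rK] : forall x : M, exists w, e w = x.
    have e_surj : [set: M] `<=` e @` [set: W] := 'surj_e.
    by move=> x; have [w _ <-] := e_surj x I; exists w.
  by exists e, r.
pose F := coded_automorphism e.
exists (Order.Disp tt tt), (restr_tree F); split.
- by apply: restr_tree_is_tree; have [] := omega1_W.
- apply: restr_tree_height; exists (fun w => (e w, e w)), id, id; split=> //.
  split; first by exists id.
  + by move=> s t; congr fun_interp; apply: eq_from_tnth => i; rewrite tnth_map.
  + move=> s t; suff -> : map_tuple id t = t by [].
    by apply: eq_from_tnth => i; rewrite tnth_map.
- apply: card_eq_trans card_Aut_M.
  apply: card_eq_trans (card_coded_automorphism rK).
  exact/card_uncountable_branches/locally_closed_coded_automorphism.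
(* Already the whole tree has at most continuum many nodes, which is $\omega_1$ by CH. *)
- move=> w; apply: card_le_trans (subset_card_le _) _; first exact: subsetT.
  apply: card_le_trans RW; apply: card_restr_tree => //.
  have /pcard_injP[b /in2TT b_inj] := card_le_trans MW WR.
  (* The Boolean tag selects the component of the pair whose bits are read. *)
  apply: (@card_le_bool_fun (bool * nat)%type _
    (fun p i => b (if i.1 then p.1 else p.2) i.2)) => -[x y] [x' y'] xy.
  congr pair; apply: b_inj; apply: funext => n.
    by have := congr1 (@^~ (true, n)) xy.
  by have := congr1 (@^~ (false, n)) xy.
Qed.
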